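(* The Continuum Hypothesis implies $\chi_{\rm CF}(\omega_1,\omega_1,\omega)=\chi_{\rm CF}(\omega_1,\omega,\omega)=\omega_1$.
   Context: For a family $\mathcal A$ and cardinal $\rho$, $f:\bigcup\mathcal A\to\rho$ is a conflict free coloring of $\mathcal A$ if for every $A\in\mathcal A$ some $\zeta<\rho$ has $|A\cap f^{-1}\{\zeta\}|=1$; $\chi_{\rm CF}(\mathcal A)$ is the least such $\rho$. A $(\lambda,\kappa,\mu)$-system is a family of $\lambda$ sets each of size $\kappa$, distinct members meeting in fewer than $\mu$ points; $\chi_{\rm CF}(\lambda,\kappa,\mu)$ is the supremum of $\chi_{\rm CF}(\mathcal A)$ over all $(\lambda,\kappa,\mu)$-systems $\mathcal A$. *)

(* Defs.v *)
From mathcomp Require Import all_boot.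
From mathcomp Require Import boolp classical_sets cardinality.
Set Implicit Arguments. Unset Strict Implicit. Unset Printing Implicit Defensive.
Local Open Scope classical_set_scope.
Local Open Scope card_scope.

(* W "is" omega_1: W carries a strict well-order all of whose proper initial
   segments are countable, while W itself is uncountable.  Such a W has
   order type (hence cardinality) exactly omega_1. *)
Definition is_omega1 (W : Type) : Prop :=
  ~ countable [set: W] /\
  exists lt : W -> W -> Prop,
    (forall x, ~ lt x x) /\
    (forall x y z, lt x y -> lt y z -> lt x z) /\
    (forall x y, lt x y \/ x = y \/ lt y x) /\
    well_founded lt /\
    (forall x, countable [set y | lt y x]).

Definition CH_for (W : Type) : Prop := [set: W] #= [set: nat -> bool].

Definition conflict_free {T C : Type} (A : set (set T)) (f : T -> C) : Prop :=
  forall A0, A A0 ->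
    exists zeta : C, exists x, A0 x /\ f x = zeta /\
      forall y, A0 y -> f y = zeta -> y = x.

(* A is a (lambda, kappa, omega)-system where lambda = |L|, kappa = |K|:
   |A| = lambda, every member has size kappa, and distinct members have
   finite (i.e. fewer than omega) intersection. *)
Definition system_omega {T L K : Type} (A : set (set T)) : Prop :=
  A #= [set: L] /\
  (forall A0, A A0 -> A0 #= [set: K]) /\
  (forall A0 A1, A A0 -> A A1 -> A0 <> A1 -> finite_set (A0 `&` A1)).

(* chi_CF(lambda,kappa,omega) = omega_1 (with W = omega_1), unfolded:
   every such system has a conflict-free colouring with omega_1 colours
   (sup <= omega_1), and some such system has no conflict-free colouring
   with countably many (omega) colours (sup > rho for every rho < omega_1). *)
Definition chiCF_eq_omega1 (L K W : Type) : Prop :=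
  (forall (T : Type) (A : set (set T)), @system_omega T L K A ->
     exists f : T -> W, conflict_free A f) /\
  (exists (T : Type) (A : set (set T)), @system_omega T L K A /\
     forall f : T -> nat, ~ conflict_free A f).

(* Main.v *)
(* For the lower bound let V = (nat -> option K) and take the tree of all maps
   x from proper initial segments of omega_1 to V; by CH it has omega_1 nodes.
   The points are pairs (node, k) with k in K, so each node carries a column of
   size |K|.  To a node s of height d attach its own column together with a
   countable set of points in the columns of restrictions s|b, b < d, that is
   finite below every level < d.  Since distinct nodes share restrictions only
   up to a level below the larger height, these sets are almost disjoint.  A
   colouring f by natural numbers defines a branch X recursively: X b records,
   for every colour c, some k with f (X|b, k) = c if there is one.  Thus the
   node X|d knows witnesses for the colours of all earlier columns, and its
   countable set can contain, for every colour c that occurs arbitrarily high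
   below d, two points of colour c.  For a suitable limit d every colour in the
   column of X|d is of this kind, so no colour occurs exactly once.  The upper
   bound only needs that the union of the system has size omega_1. *)
Require Import Defs.
From mathcomp Require Import all_boot.
From mathcomp Require Import boolp classical_sets cardinality.

Set Implicit Arguments.
Unset Strict Implicit.
Unset Printing Implicit Defensive.

Local Open Scope classical_set_scope.
Local Open Scope card_scope.

(** * Injections and codings into the Cantor space *)

Notation cantor := (nat -> bool).

Lemma card_le_injective T U (A : set T) (f : T -> U) :
  {in A &, injective f} -> A #<= [set: U].
Proof.
move=> /inj_card_eq; rewrite card_eq_le => /andP[_ /card_le_trans]; apply.
exact: card_leT.
Qed.

Lemma card_le_injP T U (A : set T) : U ->
  A #<= [set: U] -> exists f : T -> U, {in A &, injective f}.
Proof.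
elim/Ppointed: U => U; first by move=> /no.
by move=> _ /pcard_injP.
Qed.

Lemma cantor_sequence_inj : exists j : (nat -> cantor) -> cantor, injective j.
Proof.
exists (fun u n => if unpickle n is Some (i, k) then u i k else false).
move=> u v uv; apply/funext => i; apply/funext => k.
by have := congr1 (@^~ (pickle (i, k))) uv; rewrite /= pickleK.
Qed.

Lemma cantor_prod_inj : exists j : cantor * cantor -> cantor, injective j.
Proof.
have [j jinj] := cantor_sequence_inj.
exists (fun p => j (fun n => if n is 0 then p.1 else p.2)).
move=> [a b] [a' b'] /jinj E.
by congr pair; [apply: (congr1 (@^~ 0) E)|apply: (congr1 (@^~ 1) E)].
Qed.

Lemma cantor_option_inj K (j : K -> cantor) :
  injective j -> exists i : option K -> cantor, injective i.
Proof.
move=> jinj.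
exists (fun o n => if o is Some k then if n is n'.+1 then j k n' else true
                   else false).
move=> [k|] [k'|] // E.
- congr Some; apply: jinj; apply/funext => n.
  exact: (congr1 (@^~ n.+1) E).
- by have := congr1 (@^~ 0) E.
- by have := congr1 (@^~ 0) E.
Qed.

(** * The almost disjoint family on the tree *)

Section Tree.

Variables (W K : Type) (lt : W -> W -> Prop) (e : W -> nat -> W).
Hypothesis lt_irr : forall x, ~ lt x x.
Hypothesis lt_trans : forall x y z, lt x y -> lt y z -> lt x z.
Hypothesis lt_total : forall x y, lt x y \/ x = y \/ lt y x.
Hypothesis lt_wf : well_founded lt.
Hypothesis lt_enum : forall d b, lt b d -> exists n, e d n = b.
Hypothesis lt_bounded :
  forall u : nat -> W, exists d, forall n, lt (u n) d.

Let V := nat -> option K.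

Definition restr (d : W) (x : W -> V) : W -> V :=
  fun b => if pselect (lt b d) then x b else fun=> None.

(* Nodes are represented by total functions: [None] everywhere from d on. *)
Definition node (d : W) (x : W -> V) : W * (W -> V) := (d, restr d x).

(* b lies above the first c + 1 terms of the enumeration e d of the levels
   below d; hence only finitely many colours are treated below a given level. *)
Definition above (d : W) (c : nat) (b : W) : Prop :=
  lt b d /\ forall i, i <= c -> lt (e d i) d -> lt (e d i) b.

Definition witness_pair (d : W) (x : W -> V) (c : nat) (p : W * W) : Prop :=
  [/\ above d c p.1, above d c p.2, p.1 <> p.2,
      x p.1 c <> None & x p.2 c <> None].

(** The default [(d, d)] is never a witness pair, so [support] can test whether a colour has one. *)
Definition pick_pair (d : W) (x : W -> V) (c : nat) : W * W :=
  @xget {classic (W * W)} (d, d) (witness_pair d x c).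

Lemma pick_pairP d x c p :
  witness_pair d x c p -> witness_pair d x c (pick_pair d x c).
Proof. exact: (@xgetI {classic (W * W)}). Qed.

Definition support (d : W) (x : W -> V) : set ((W * (W -> V)) * K) :=
  [set q | exists c b,
    [/\ witness_pair d x c (pick_pair d x c),
        b = (pick_pair d x c).1 \/ b = (pick_pair d x c).2,
        q.1 = node b x & x b c = Some q.2]].

Definition member (d : W) (x : W -> V) : set ((W * (W -> V)) * K) :=
  support d x `|` [set q | q.1 = node d x].

Lemma restr_lt d x b : lt b d -> restr d x b = x b.
Proof. by rewrite /restr; case: pselect. Qed.

Lemma node_restr d x b : lt b d \/ b = d -> node b (restr d x) = node b x.
Proof.
move=> bd; congr pair; apply/funext => a; rewrite /restr.
case: pselect => // ab; case: pselect => // -[].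
by case: bd => [|<-//]; exact: lt_trans.
Qed.

Lemma support_node d x q : support d x q -> q.1 = node q.1.1 x /\ lt q.1.1 d.
Proof.
by move=> [c [b [[[? _] [? _] _ _ _] [->|->] -> _]]].
Qed.

Lemma member_node d x q :
  member d x q -> q.1 = node q.1.1 x /\ (lt q.1.1 d \/ q.1.1 = d).
Proof.
by move=> [/support_node[-> ?]|/= ->]; split=> //; [left|right].
Qed.

Lemma member_support d x q : member d x q -> lt q.1.1 d -> support d x q.
Proof. by move=> [//|/= ->] /lt_irr. Qed.

(** If [g] is [e d i], the pairs of all colours [c >= i] lie above [g]; only the colours below [i]
    remain, each contributing at most two points. *)
Lemma support_finite d x g : lt g d ->
  finite_set (support d x `&` [set q | ~ lt g q.1.1]).
Proof.
move=> gd; have [i ei] := lt_enum gd.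
pose Q c b := [set q : (W * (W -> V)) * K | q.1 = node b x /\ x b c = Some q.2].
have finQ c b : finite_set (Q c b).
  case E : (x b c) => [k|].
    apply: sub_finite_set (finite_set1 (node b x, k)).
    by move=> [n k'] [/= -> ]; rewrite E => -[->].
  by apply: sub_finite_set (finite_set0 _) => q []; rewrite E.
pose F c := Q c (pick_pair d x c).1 `|` Q c (pick_pair d x c).2.
apply: (@sub_finite_set _ _ (\bigcup_(c in `I_i) F c)).
  move=> q [[c [b [[a1 a2 _ _ _] bE q1 q2]]] /= nlt]; exists c.
    rewrite /= ltnNge; apply/negP => ic; apply: nlt; rewrite q1 /= -ei.
    by case: bE => ->; [case: a1 => _|case: a2 => _]; apply=> //; rewrite ei.
  by case: bE => bE; [left|right]; rewrite /Q -bE.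
by apply: bigcup_finite => // c _; rewrite finite_setU.
Qed.

(** A common point lies at or below the smaller height or, for equal heights, at or below a level
    [b0] where the nodes differ; [support_finite] then applies. *)
Lemma member_almost_disjoint d x d' x' :
  x = restr d x -> x' = restr d' x' -> member d x <> member d' x' ->
  finite_set (member d x `&` member d' x').
Proof.
move=> xE xE' neq.
have main d1 x1 d2 x2 : lt d1 d2 -> finite_set (member d1 x1 `&` member d2 x2).
  move=> lt12; apply: sub_finite_set (support_finite x2 lt12).
  move=> q [/member_node[_ q1] q2]; split; last first.
    move=> /= dq; case: q1 => q1; first exact: lt_irr (lt_trans q1 dq).
    by apply: (@lt_irr d1); rewrite -{2}q1.
  apply: member_support q2 _.
  by case: q1 => [q1|->//]; exact: lt_trans lt12.
case: (lt_total d d') => [/main//|[dd|/main]]; last by rewrite setIC.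
subst d'.
have /existsNP[b0 nb0] : ~ forall b, x b = x' b.
  by move=> /funext xx; apply: neq; rewrite xx.
have b0d : lt b0 d.
  apply: contrapT => nlt; apply: nb0; rewrite xE xE' /restr.
  by case: pselect.
apply: sub_finite_set (support_finite x b0d) => q [qx qx'].
have [q1 qd] := member_node qx; have [q1' _] := member_node qx'.
have nlt : ~ lt b0 q.1.1.
  move=> b0q; apply: nb0; have : node q.1.1 x = node q.1.1 x' by rewrite -q1.
  by move=> [/(congr1 (@^~ b0))]; rewrite !restr_lt.
split=> //; apply: member_support (qx) _.
by case: qd => // qd; case: nlt; rewrite qd.
Qed.

Lemma member_top d x w : member d x (node d x, w).
Proof. by right. Qed.

Lemma card_member d x :
  [set: K * nat] #<= [set: K] -> member d x #= [set: K].
Proof.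
move=> KN; rewrite card_eq_le; apply/andP; split.
  (* With a height above [d], the enumeration [e d'] reaches [d] itself as well as the smaller
     levels. *)
  have [d' dd'] := lt_bounded (fun=> d).
  have idx b : exists n, lt b d' -> e d' n = b.
    by have [/lt_enum[n]|] := pselect (lt b d'); [exists n|exists 0].
  have [r rP] := choice idx.
  apply: card_le_trans KN.
  apply: (@card_le_injective _ _ _ (fun q => (q.2, r q.1.1))).
  move=> [s w] [s' w'] /set_mem/member_node[/= sE sd].
  move=> /set_mem/member_node[/= sE' sd'] [-> rr].
  have below b : lt b d \/ b = d -> lt b d'.
    by move=> [/lt_trans|->]; [apply; exact: dd' 0|exact: dd' 0].
  rewrite sE sE'; congr (node _ x, _).
  by rewrite -[s.1]rP ?rr ?rP//; exact: below.
have : [set (node d x, w) | w in [set: K]] #= [set: K].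
  by apply: inj_card_eq => w w' _ _ [].
rewrite card_eq_le => /andP[_] /card_le_trans; apply.
by apply: subset_card_le => _ [w _ <-]; exact: member_top.
Qed.

(** A node is coded by its height and its values along the enumeration [e d] of the levels below. *)
Lemma card_nodes :
  [set: W] #<= [set: cantor] -> [set: K] #<= [set: cantor] ->
  [set s : W * (W -> V) | s.2 = restr s.1 s.2] #<= [set: cantor].
Proof.
move=> /pcard_injP[jW jWinj] /pcard_injP[jK jKinj].
have [jo joinj] : exists i : option K -> cantor, injective i.
  by apply: (@cantor_option_inj _ jK) => k k' /jKinj; apply; exact: in_setT.
have [js jsinj] := cantor_sequence_inj.
have [jp jpinj] := cantor_prod_inj.
pose code (s : W * (W -> V)) : cantor :=
  jp (jW s.1, js (fun n => js (fun c => jo (s.2 (e s.1 n) c)))).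
apply: (@card_le_injective _ _ _ code) => -[d x] [d' x'].
move=> /set_mem/= xE /set_mem/= xE' /jpinj[/jWinj].
rewrite !in_setT => /(_ isT isT) dd; subst d' => /jsinj xx.
congr pair; rewrite xE xE'; apply/funext => b; rewrite /restr.
case: pselect => //= bd; have [n <-] := lt_enum bd; apply/funext => c.
exact/joinj/(congr1 (@^~ c) (jsinj _ _ (congr1 (@^~ n) xx))).
Qed.

(** * The diagonal branch and reflection at a limit level *)

(** Since [node d X] uses only the values of [X] below [d], the colours in its column may define
    [X d] by well-founded recursion. *)
Lemma exists_branch (f : (W * (W -> V)) * K -> nat) : exists X : W -> V,
  forall d c, (forall w, X d c = Some w -> f (node d X, w) = c) /\
              (forall w, f (node d X, w) = c -> X d c <> None).
Proof.
pose wit s : V := fun c =>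
  if pselect (exists w, f (s, w) = c) is left h then Some (projT1 (cid h))
  else None.
pose step d (rec : forall b, lt b d -> V) : V :=
  wit (d, fun b => if pselect (lt b d) is left h then rec b h else fun=> None).
pose X := Fix lt_wf (fun=> V) step.
have XE d : X d = wit (node d X).
  rewrite /X Fix_eq; last first.
  - move=> a g g' gg; congr (wit (_, _)); apply/funext => b.
    by case: pselect.
  - congr (wit (_, _)); apply/funext => b.
    by rewrite /restr; case: pselect.
exists X => d c; rewrite XE /wit; case: pselect => h; split=> // w.
- by move=> [<-]; exact: projT2 (cid h).
- by move=> fw; case: h; exists w.
Qed.

Lemma lt_min (P : W -> Prop) a : P a ->
  exists m, P m /\ forall b, lt b m -> ~ P b.
Proof.
move: a; apply: (well_founded_ind lt_wf) => a IH Pa.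
have [[b [ba Pb]]|h] := pselect (exists b, lt b a /\ P b); first exact: IH ba Pb.
by exists a; split=> // b ba Pb; apply: h; exists b.
Qed.

Lemma exists_reflecting_step (S : nat -> set W) g : exists g',
  lt g g' /\ forall c b, b = g' \/ lt g' b -> S c b ->
    exists b', [/\ lt g b', lt b' g' & S c b'].
Proof.
have /choice[u uP] c : exists b', forall b, lt g b -> S c b -> lt g b' /\ S c b'.
  have [[b [gb Sb]]|h] := pselect (exists b, lt g b /\ S c b); first by exists b.
  by exists g => b gb Sb; case: h; exists b.
(* Entry 0 puts [g'] above [g]; entry [c.+1] puts it above a chosen point of [S c] beyond [g], if
   there is one. *)
have [g' g'P] := lt_bounded (fun n => if n is c.+1 then u c else g).
have gg' := g'P 0.
exists g'; split=> // c b bg Sb.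
have gb : lt g b by case: bg => [->//|]; exact: lt_trans gg'.
by have [? ?] := uP c b gb Sb; exists (u c); split=> //; exact: (g'P c.+1).
Qed.

(* d is the supremum of the iterates of the reflecting step, so that every S c
   containing d meets each interval between consecutive iterates. *)
Lemma exists_reflecting_limit (S : nat -> set W) (w0 : W) : exists d,
  forall c, S c d ->
    exists p, [/\ above d c p.1, above d c p.2, p.1 <> p.2, S c p.1 & S c p.2].
Proof.
have [h hP] := choice (exists_reflecting_step S).
pose t n := iter n h w0.
have tS n : lt (t n) (t n.+1) by have [] := hP (t n).
have tmono m n : m <= n -> t m = t n \/ lt (t m) (t n).
  elim: n => [|n IH]; first by rewrite leqn0 => /eqP->; left.
  rewrite leq_eqVlt => /predU1P[->|/IH]; first by left.
  by move=> [->|mn]; right=> //; exact: lt_trans mn (tS n).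
have [a ta] := lt_bounded t.
have [d [td dmin]] := lt_min (P := fun a => forall n, lt (t n) a) ta.
have cofinal g : lt g d -> exists n, lt g (t n).
  move=> /dmin/existsNP[n nlt]; exists n.+1.
  by case: (lt_total (t n) g) => [//|[<-//|/lt_trans gt]]; exact: gt.
(* One iterate exceeds all levels below [d] among the first [c + 1] enumerated terms, as [above d c]
   requires. *)
have common c : exists N, forall i, i <= c -> lt (e d i) d -> lt (e d i) (t N).
  elim: c => [|c [N NP]].
    have [/cofinal[n ?]|nlt] := pselect (lt (e d 0) d).
      by exists n => i; rewrite leqn0 => /eqP->.
    by exists 0 => i; rewrite leqn0 => /eqP->.
  have [n nP] : exists n, lt (e d c.+1) d -> lt (e d c.+1) (t n).
    by have [/cofinal[n ?]|?] := pselect (lt (e d c.+1) d); [exists n|exists 0].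
  exists (maxn N n) => i; rewrite leq_eqVlt ltnS => /predU1P[->|ic] ed.
    have := nP ed; have /tmono[<-//|lt2 lt1] : n <= maxn N n by exact: leq_maxr.
    exact: lt_trans lt2.
  have := NP _ ic ed; have /tmono[<-//|lt2 lt1] : N <= maxn N n by exact: leq_maxl.
  exact: lt_trans lt2.
exists d => c Sd; have [N NP] := common c.
have next n : exists b, [/\ lt (t n) b, lt b (t n.+1) & S c b].
  by have [_ /(_ c d)] := hP (t n); apply=> //; right; exact: (td n.+1).
(* Two consecutive intervals beyond [t N] supply two different levels. *)
have [b [Nb bN Sb]] := next N; have [b' [Nb' bN' Sb']] := next N.+1.
have bb' : lt b b' by exact: lt_trans Nb'.
exists (b, b'); split=> //=.
- split=> [|i ic ed]; first exact: lt_trans bN (td _).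
  exact: lt_trans (NP _ ic ed) Nb.
- split=> [|i ic ed]; first exact: lt_trans bN' (td _).
  exact: lt_trans (lt_trans (NP _ ic ed) Nb) bb'.
- by move=> bE; apply: (@lt_irr b); rewrite {2}bE.
Qed.

Lemma member_not_conflict_free (w0 : W) (f : (W * (W -> V)) * K -> nat) :
  exists d x, x = restr d x /\
    forall q, member d x q -> exists q', [/\ member d x q', f q' = f q & q' <> q].
Proof.
have [X XP] := exists_branch f.
(* Here [X b c <> None] means that colour [c] occurs in the column of [node b X]. *)
have [d dP] := exists_reflecting_limit (fun c => [set b | X b c <> None]) w0.
exists d, (restr d X); split.
  by apply/funext => b; rewrite /restr; case: pselect.
set x := restr d X.
have xX b : lt b d -> x b = X b by exact: restr_lt.
have nodeE b : lt b d \/ b = d -> node b x = node b X by exact: node_restr.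
(* One of the two levels of the pair differs from [b]. *)
have other c b : witness_pair d x c (pick_pair d x c) ->
    exists q', [/\ support d x q', f q' = c & q'.1.1 <> b].
  move=> pP; have [[p1d _] [p2d _] p12 x1 x2] := pP.
  have [pb|pb] := pselect ((pick_pair d x c).1 = b).
  - case E : (x (pick_pair d x c).2 c) x2 => [w|] // _.
    exists (node (pick_pair d x c).2 x, w); split.
    + by exists c, (pick_pair d x c).2; split=> //; right.
    + by rewrite nodeE; [apply: (XP _ c).1; rewrite -xX|left].
    + by rewrite /= -pb; apply/nesym.
  - case E : (x (pick_pair d x c).1 c) x1 => [w|] // _.
    exists (node (pick_pair d x c).1 x, w); split=> //.
    + by exists c, (pick_pair d x c).1; split=> //; left.
    + by rewrite nodeE; [apply: (XP _ c).1; rewrite -xX|left].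
move=> [s w] qm; have [c [cP cE]] : exists c,
    witness_pair d x c (pick_pair d x c) /\ f (s, w) = c.
  case: qm => [[c [b [pP bE /= -> xb]]]|/= ->].
    have bd : lt b d by case: pP bE => [[? _] [? _] _ _ _] [->|->].
    exists c; split=> //; rewrite nodeE; last by left.
    by apply: (XP _ c).1; rewrite -xX.
  exists (f (node d x, w)); split=> //.
  (* A colour in the top column occurs at level [d] itself, so reflection supplies a pair below. *)
  have [|p [p1 p2 p12 S1 S2]] := dP (f (node d x, w)).
    by rewrite nodeE; [exact: (XP _ _).2|right].
  apply: (pick_pairP (p := p)).
  by split=> //; rewrite xX //; [case: p1|case: p2].
have [q' [q'm q'c neq]] := other c s.1 cP.
exists q'; split; [by left|by rewrite q'c cE|by move=> qE; rewrite qE in neq].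
Qed.

End Tree.

(** * The two bounds for systems of size omega_1 *)

(** Otherwise [W] is the union of countably many countable sets, the points up to each [u n]. *)
Lemma omega1_bounded W (lt : W -> W -> Prop) :
  ~ countable [set: W] ->
  (forall x y, lt x y \/ x = y \/ lt y x) ->
  (forall x, countable [set y | lt y x]) ->
  forall u : nat -> W, exists d, forall n, lt (u n) d.
Proof.
move=> Wunc tot cnt u; apply: contrapT => /forallNP nb; apply: Wunc.
pose F (p : nat * bool) := if p.2 then [set u p.1] else [set y | lt y (u p.1)].
have cF p : countable (F p).
  by rewrite /F; case: p.2 => //; exact: countable1.
apply: sub_countable (bigcup_countable (countableP setT) (fun p _ => cF p)).
apply: subset_card_le => d _; have /existsNP[n nlt] := nb d.
by case: (tot (u n) d) => [//|[<-|?]]; [exists (n, true)|exists (n, false)].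
Qed.

Lemma exists_system_not_countably_colourable (W K : Type) :
  is_omega1 W -> CH_for W -> K -> [set: K * nat] #<= [set: K] ->
  [set: K] #<= [set: W] ->
  exists (T : Type) (A : set (set T)), @system_omega T W K A /\
    forall f : T -> nat, ~ conflict_free A f.
Proof.
move=> [Wunc [lt [irr [trans [tot [wf cnt]]]]]] CH k0 KN KW.
have [w0 _] : [set: W] !=set0.
  by apply/set0P/negP => /eqP W0; apply: Wunc; rewrite W0.
have WC : [set: W] #<= [set: cantor].
  by move: CH; rewrite /CH_for card_eq_le => /andP[].
have CW : [set: cantor] #<= [set: W].
  by move: CH; rewrite /CH_for card_eq_le => /andP[].
have bounded := omega1_bounded Wunc tot cnt.
have /choice[e eP] d : exists u : nat -> W, forall b, lt b d -> exists n, u n = b.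
  have /countable_injP[r rinj] := cnt d.
  (* Indices coding no level below [d] get [w0], which may fail to lie below [d]; the test
     [lt (e d i) d] in [above] guards against this. *)
  have /choice[u uP] n : exists a, forall b, lt b d -> r b = n -> a = b.
    have [[a [ad ra]]|h] := pselect (exists a, lt a d /\ r a = n).
      by exists a => b bd rb; apply: rinj; rewrite ?inE// ra.
    by exists w0 => b bd rb; case: h; exists b.
  by exists u => b bd; exists (r b); exact: uP.
pose nodes := [set s : W * (W -> nat -> option K) | s.2 = restr lt s.1 s.2].
pose A := [set member lt e s.1 s.2 | s in nodes].
exists _, A; split; last first.
  move=> f.
  have [d [x [xE dx]]] :=
    member_not_conflict_free e irr trans tot wf bounded w0 f.
  move=> /(_ (member lt e d x)) []; first by exists (d, x).
  move=> c [q [qm [<- quniq]]].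
  by have [q' [q'm fq /[dup] qq []]] := dx q qm; exact: quniq.
split; [|split].
- rewrite card_eq_le; apply/andP; split.
    apply: card_le_trans (card_image_le _ _) _.
    exact: card_le_trans (card_nodes eP WC (card_le_trans KW WC)) CW.
  (* The empty branches of all heights give distinct members: each contains a point at its height
     and none higher. *)
  pose g d := member lt e d (fun=> fun=> @None K).
  have : range g #= [set: W].
    apply: inj_card_eq => d d' _ _ gE.
    have m := member_top lt e d (fun=> fun=> None) k0.
    have m' := member_top lt e d' (fun=> fun=> None) k0.
    move: m m'; rewrite -/(g d) -/(g d') {1}gE -{2}gE => m m'.
    have [_ [/= dd'|//]] := member_node m.
    have [_ [/= /(trans _ _ _ dd')/irr|//]] := member_node m'.
    by [].
  rewrite card_eq_le => /andP[_] /card_le_trans; apply.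
  apply: subset_card_le => _ [d _ <-]; exists (d, fun=> fun=> None) => //.
  by apply/funext => b; rewrite /restr; case: pselect.
- by move=> _ [s _ <-]; exact: card_member.
- move=> _ _ [s sE <-] [s' sE' <-].
  exact: member_almost_disjoint.
Qed.

(** The colour of a point codes a chosen member containing it and its index there. This is injective
    on the union, so any point of a member is uniquely coloured. *)
Lemma exists_injective_colouring (W K T : Type) (A : set (set T)) :
  W -> K -> [set: W * W] #<= [set: W] -> [set: K] #<= [set: W] ->
  @system_omega T W K A -> exists f : T -> W, conflict_free A f.
Proof.
move=> w0 k0 WW KW [AW [AK _]].
have [g ginj] : exists g : set T -> W, {in A &, injective g}.
  by apply: card_le_injP => //; move: AW; rewrite card_eq_le => /andP[].
have /choice[h hinj] B : exists h : T -> W, A B -> {in B &, injective h}.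
  have [AB|] := pselect (A B); last by exists (fun=> w0).
  have [|h] := @card_le_injP T W B w0; last by exists h.
  by apply: card_le_trans KW; move: (AK _ AB); rewrite card_eq_le => /andP[].
have [j jinj] := card_le_injP w0 WW.
have /choice[S SP] x : exists B, (exists2 C, A C & C x) -> A B /\ B x.
  have [[C AC Cx]|] := pselect (exists2 C, A C & C x); first by exists C.
  by exists setT.
exists (fun x => j (g (S x), h (S x) x)) => B AB.
have [x Bx] : B !=set0.
  apply/set0P/negP => /eqP B0; have := AK _ AB.
  rewrite B0 card_eq_sym card_eq0 => /eqP K0.
  by have : [set: K] k0 by []; rewrite K0.
exists (j (g (S x), h (S x) x)), x; split=> //; split=> // y By.
move=> /jinj; rewrite !in_setT => /(_ isT isT) [gE hE].
have [ASx Sx] : A (S x) /\ S x x by apply: SP; exists B.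
have [ASy Sy] : A (S y) /\ S y y by apply: SP; exists B.
have SE : S y = S x by apply: ginj; rewrite ?inE.
move: hE Sy; rewrite SE => hE Sy.
by apply: (hinj _ ASx) => //; rewrite inE.
Qed.

Theorem theorem10p3 (W : Type) :
  is_omega1 W -> CH_for W ->
  chiCF_eq_omega1 W W W /\ chiCF_eq_omega1 W nat W.
Proof.
move=> W1 CH; have [Wunc _] := W1.
have Winf : [set: nat] #<= [set: W].
  by apply/infiniteP => /finite_set_countable.
have [w0 _] : [set: W] !=set0.
  by apply/set0P/negP => /eqP W0; apply: Wunc; rewrite W0.
have WC : [set: W] #<= [set: cantor].
  by move: CH; rewrite /CH_for card_eq_le => /andP[].
have CW : [set: cantor] #<= [set: W].
  by move: CH; rewrite /CH_for card_eq_le => /andP[].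
(* CH carries the squaring of the Cantor space over to [W]. *)
have WW : [set: W * W] #<= [set: W].
  apply: card_le_trans CW; have [i iinj] := card_le_injP (fun=> false) WC.
  have [jp jpinj] := cantor_prod_inj.
  apply: (@card_le_injective _ _ _ (fun p => jp (i p.1, i p.2))).
  move=> [a b] [a' b'] _ _ /jpinj[/iinj + /iinj].
  by rewrite !in_setT => -> // ->.
have WN : [set: W * nat] #<= [set: W].
  apply: card_le_trans WW; have [i iinj] := card_le_injP w0 Winf.
  apply: (@card_le_injective _ _ _ (fun p => (p.1, i p.2))).
  by move=> [a b] [a' b'] _ _ [-> /iinj]; rewrite !in_setT => ->.
have NN : [set: nat * nat] #<= [set: nat].
  by have := card_nat2; rewrite card_eq_le => /andP[].
split; split.
- by move=> T A; exact: (exists_injective_colouring w0 w0 WW (card_lexx _)).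
- exact: (exists_system_not_countably_colourable W1 CH w0 WN (card_lexx _)).
- by move=> T A; exact: (exists_injective_colouring w0 0 WW Winf).
- exact: (exists_system_not_countably_colourable W1 CH 0 NN Winf).
Qed.
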